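(* Let $G$ be a connected graph of order $n$, minimum degree $\delta \geq 3$, maximum degree at least $\Delta$ and girth at least $6$. Then \[ \operatorname{avec}(G) \leq \frac{n-\Delta^*}{2\delta^*} \cdot \frac{9n+3\Delta^*}{n} + 21, \] where $\delta^* = 2(\delta^2-\delta+1)$ and $\Delta^* = \Delta\delta + (\delta-1)\sqrt{\Delta(\delta-2)} + \frac{3}{2}$.
   Context: All graphs are finite and simple. For a connected graph $G$, the eccentricity $e_G(v)$ of a vertex $v$ is $\max_{w\in V(G)} d_G(v,w)$, where $d_G$ is the shortest-path distance, and the average eccentricity is $\operatorname{avec}(G)=\frac{1}{n}\sum_{v\in V(G)} e_G(v)$ with $n=|V(G)|$. The girth of $G$ is the length of a shortest cycle in $G$. *)

(* Defs.v *)
From HB Require Import structures.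
From mathcomp Require Import all_boot all_order all_algebra.
Set Implicit Arguments.
Unset Strict Implicit.
Unset Printing Implicit Defensive.
Import Order.TTheory GRing.Theory Num.Theory.

Record sgraph := SGraph {
  vertex :> finType;
  adj : rel vertex;
  adj_sym : symmetric adj;
  adj_irr : irreflexive adj
}.
Arguments adj {s} : rename.

Definition connected_graph (G : sgraph) : Prop :=
  0 < #|G| /\ forall x y : G, connect adj x y.

Definition degree (G : sgraph) (v : G) : nat := #|[set w : G | adj v w]|.

(* Degrees are below #|G|, so the default value #|G| does not affect the
   minimum of a nonempty graph. *)
Definition min_degree (G : sgraph) : nat := \big[minn/#|G|]_(v : G) degree v.

Definition max_degree (G : sgraph) : nat := \max_(v : G) degree v.

(* A shortest path has fewer than #|G| edges; the default value #|G| is only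
   reached when no path from x to y exists. *)
Definition dist (G : sgraph) (x y : G) : nat :=
  \big[minn/#|G|]_(k < #|G| |
    [exists p : k.-tuple G, path adj x p && (last x p == y)]) k.

Definition ecc (G : sgraph) (v : G) : nat := \max_(w : G) dist v w.

Definition avec (R : numFieldType) (G : sgraph) : R :=
  ((\sum_(v : G) ecc v)%N%:R / #|G|%:R)%R.

(* The bound on the size excludes the closed walks of length at most 2, which
   ucycleb accepts. *)
Definition is_cycle (G : sgraph) (c : seq G) : bool :=
  (3 <= size c) && ucycleb adj c.

(* A cycle has at most #|G| vertices; the default value #|G|.+1 is only reached
   by acyclic graphs. *)
Definition girth (G : sgraph) : nat :=
  \big[minn/#|G|.+1]_(k < #|G|.+1 | [exists c : k.-tuple G, is_cycle c]) k.

Definition delta_star (R : numFieldType) (delta : nat) : R :=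
  (2 * (delta%:R ^+ 2 - delta%:R + 1))%R.

Definition Delta_star (R : rcfType) (Delta delta : nat) : R :=
  (Delta%:R * delta%:R
   + (delta%:R - 1) * Num.sqrt (Delta%:R * (delta%:R - 2)) + 3 / 2)%R.

(* Main.v *)
(* Fix a vertex [v] of maximum degree. As the girth is at least 6, the vertices
   within distance 2 of an edge number at least [delta_star], and the ball of
   radius 3 around [v] has at least [Delta_star] vertices. Pick a maximal family
   of disjoint clusters, namely this ball and such edge neighbourhoods, in which
   each new centre is within distance 6 of an earlier one: then every vertex is
   within distance 6 of a centre, and [m] clusters satisfy
   [(m - 1) delta_star <= n - Delta_star].

   Let [c] be a centre of minimum eccentricity [rho] in the graph linking the
   centres at distance at most 6. A vertex whose cluster is at link distance [j]
   from [c] has eccentricity at most [12 + 6 (rho + j)]. Minimality of [rho] forces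
   two clusters at each link distance [0 < j < rho], so [2 rho <= m] and the
   sum of all eccentricities is at most
   [12 n (1 + rho) - 6 delta_star rho^2], which is increasing in [rho] in the
   relevant range. *)
Require Import Defs.
From HB Require Import structures.
From mathcomp Require Import all_boot all_order all_algebra.
From mathcomp Require Import zify ring lra.
Set Implicit Arguments.
Unset Strict Implicit.
Unset Printing Implicit Defensive.
Import Order.TTheory GRing.Theory Num.Theory.

(** * Double counting, and balls of a finite relation *)

Lemma double_count (S T : finType) (e : S -> T -> bool) (A : {set S})
    (B : {set T}) (k l : nat) :
  (forall a, a \in A -> k <= #|[set b in B | e a b]|) ->
  (forall b, b \in B -> #|[set a in A | e a b]| <= l) ->
  #|A| * k <= #|B| * l.
Proof.
move=> hA hB; rewrite -!sum_nat_const.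
apply: (@leq_trans (\sum_(a in A) #|[set b in B | e a b]|)); first exact: leq_sum.
apply: (@leq_trans (\sum_(b in B) #|[set a in A | e a b]|)); last exact: leq_sum.
under eq_bigr => a _ do rewrite -sum1dep_card big_mkcondr /=.
under [leqRHS]eq_bigr => b _ do rewrite -sum1dep_card big_mkcondr /=.
by rewrite exchange_big.
Qed.

Section Ball.
Variables (T : finType) (r : rel T).

(** Stated for an arbitrary relation because it serves both for [adj] and for [link]. *)
Fixpoint ball (k : nat) (x : T) : {set T} :=
  if k is k'.+1 then
    [set y | (y \in ball k' x) || [exists z in ball k' x, r z y]]
  else [set x].

Lemma ball0 x : x \in ball 0 x. Proof. by rewrite inE. Qed.

Lemma ballS k x y : y \in ball k x -> y \in ball k.+1 x.
Proof. by move=> h; rewrite inE h. Qed.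

Lemma ball_step k x y z : y \in ball k x -> r y z -> z \in ball k.+1 x.
Proof. by move=> h yz; rewrite inE; apply/orP; right; apply/exists_inP; exists y. Qed.

Lemma ballSP k x y :
  y \in ball k.+1 x -> y \in ball k x \/ exists2 z, z \in ball k x & r z y.
Proof. by rewrite inE => /orP[->|/exists_inP[z]]; [left | right; exists z]. Qed.

Lemma ball_trans i j x y z : y \in ball i x -> z \in ball j y -> z \in ball (i + j) x.
Proof.
move=> hy; elim: j z => [z|j IH z]; first by rewrite inE addn0 => /eqP->.
rewrite addnS => /ballSP[/IH/ballS //|[w /IH hw wz]]; exact: ball_step hw wz.
Qed.

Lemma ball_mono i j x : i <= j -> ball i x \subset ball j x.
Proof.
move/subnKC <-; apply/subsetP => y hy; elim: (j - i) => [|m IH]; rewrite ?addn0 //.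
by rewrite addnS; apply: ballS.
Qed.

Lemma ball_leq i j x y : i <= j -> y \in ball i x -> y \in ball j x.
Proof. by move=> /(ball_mono x)/subsetP; apply. Qed.

Lemma ball1 x y : r x y -> y \in ball 1 x.
Proof. exact/ball_step/ball0. Qed.

Lemma ball_pathP k x y : y \in ball k x ->
  exists p, [/\ size p <= k, path r x p & last x p = y].
Proof.
elim: k y => [y|k IH y].
  by rewrite inE => /eqP->; exists [::].
case/ballSP=> [/IH[p [hs hp hl]]|[z /IH[p [hs hp hl]] zy]].
  by exists p; split=> //; apply: leqW.
by exists (rcons p y); rewrite size_rcons rcons_path last_rcons hp hl.
Qed.

Lemma path_ball x p : path r x p -> last x p \in ball (size p) x.
Proof.
elim/last_ind: p => [|p y IH]; first by rewrite ball0.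
rewrite rcons_path last_rcons size_rcons => /andP[/IH h]; exact: ball_step.
Qed.

Lemma connect_ball x y : connect r x y -> y \in ball #|T| x.
Proof.
case/connectP=> p /shortenP[q hq uq _] ->.
apply: ball_leq (path_ball hq).
by have := max_card (mem (x :: q)); rewrite (card_uniqP uq) => /ltnW.
Qed.

(* The sum counts the radii below [k] that miss [y]: it is the distance. *)
Lemma ball_sum k x y : y \in ball k x ->
  y \in ball (\sum_(j < k) (y \notin ball j x)) x.
Proof.
elim: k => [|k IH hy]; first by rewrite big_ord0.
rewrite big_ord_recr /=; case: (boolP (y \in ball k x)) => [/IH|hn].
  by rewrite addn0.
suff -> : \sum_(j < k) (y \notin ball j x) = k by rewrite addn1.
rewrite -[RHS](card_ord k) -sum1_card; apply: eq_bigr => j _.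
by rewrite (contra _ hn) // => /ball_leq; apply; apply: ltnW.
Qed.

Lemma ball_sub (F : {set T}) k x :
  (forall x y, r x y -> y \in F) -> x \in F -> ball k x \subset F.
Proof.
move=> hF xF; elim: k => [|k /subsetP IH]; first by rewrite sub1set.
by apply/subsetP => y /ballSP[/IH|[z _ /hF]].
Qed.

Hypothesis r_sym : symmetric r.

Lemma ball_sym k x y : y \in ball k x -> x \in ball k y.
Proof.
elim: k y => [y|k IH y]; first by rewrite !inE eq_sym.
case/ballSP=> [/IH/ballS //|[z /IH hz]]; rewrite r_sym => /ball1 yz.
by rewrite -add1n; apply: ball_trans hz.
Qed.

Lemma ball_first k x y : y \in ball k.+1 x ->
  exists2 z, z \in ball 1 x & y \in ball k z.
Proof.
move/ball_sym/ballSP=> [/ball_sym h|[z /ball_sym h]].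
  by exists x => //; apply: ballS; apply: ball0.
by rewrite r_sym => /ball1; exists z.
Qed.

(** When [u] is the only possible vertex of the sphere of radius [j.+1], every path leaving
    [ball j c] goes through [u], after at least [j.+1] steps. *)
Lemma ball_cut j i c u : ball j.+1 c \subset u |: ball j c ->
  ball (j.+1 + i) c \subset ball j c :|: ball i u.
Proof.
move=> /subsetP hs; elim: i => [|i /subsetP IH].
  by apply/subsetP => y; rewrite addn0 => /hs; rewrite !inE orbC.
apply/subsetP => y; rewrite addnS => /ballSP[/IH|[z /IH]].
  rewrite !in_setU => /orP[->//|/ballS->]; exact: orbT.
rewrite !in_setU => /orP[hz zy|hz zy].
  have := hs _ (ball_step hz zy); rewrite !in_setU in_set1 => /orP[/eqP->|->] //.
  by rewrite (ball_leq (leq0n i.+1) (ball0 u)) orbT.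
by rewrite (ball_step hz zy) orbT.
Qed.

(* If some sphere of radius [0 < j < rho] around a center [c] had at most one
   vertex [u], a neighbour of [c] towards [u] would have smaller eccentricity. *)
Lemma center_exists (F : {set T}) (x0 : T) (k : nat) :
  (forall x y, r x y -> y \in F) -> x0 \in F -> F \subset ball k x0 ->
  exists c rho, [/\ c \in F, F \subset ball rho c,
    forall j, j < rho -> j.*2.+1 <= #|ball j c| & rho.*2 <= #|F|].
Proof.
move=> hF x0F hk.
have ex : exists k, [exists c in F, F \subset ball k c].
  by exists k; apply/exists_inP; exists x0.
case: (ex_minnP ex) => rho /exists_inP[c cF hc] hmin.
have nsub j c' : c' \in F -> j < rho -> ~~ (F \subset ball j c').
  move=> c'F jr; apply/negP => h; have: rho <= j.
    by apply: hmin; apply/exists_inP; exists c'.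
  by rewrite leqNgt jr.
have grow j : j.+1 < rho -> #|ball j c|.+2 <= #|ball j.+1 c|.
  move=> jr; rewrite leqNgt; apply/negP => hlt.
  have hd : #|ball j.+1 c :\: ball j c| <= 1.
    rewrite cardsD (setIidPr (ball_mono c (leqnSn j))); lia.
  have [u hu hs] : exists2 u, u \in ball j.+1 c & ball j.+1 c \subset u |: ball j c.
    have [h0|[u]] := set_0Vmem (ball j.+1 c :\: ball j c).
      exists c; first exact: ball_leq (ball0 c).
      by rewrite subsetU // orbC -setD_eq0 h0 eqxx.
    move=> hu; exists u; first by case/setDP: hu.
    move: hd; rewrite leq_eqVlt ltnS leqn0 cards_eq0 => /orP[/cards1P[w hw]|/eqP h0]; last first.
      by rewrite h0 inE in hu.
    by move: hu; rewrite hw inE => /eqP->; rewrite setUC -subDset hw.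
  have [c' hc' huc'] := ball_first hu.
  have c'F : c' \in F by apply: (subsetP (ball_sub 1 hF cF)).
  have := ball_cut (rho - j.+1) hs; rewrite subnKC; last exact: ltnW.
  move/subsetP=> hcut.
  (* From [c'], a vertex is reached in [1 + j] steps through [c] or in [j + (rho - j.+1)] steps
     through [u]; both are below [rho]. *)
  have /negP[] := nsub rho.-1 c' c'F ltac:(lia).
  apply/subsetP => y /(subsetP hc)/hcut; rewrite in_setU => /orP[] hy.
    by apply: ball_leq (ball_trans (ball_sym hc') hy); lia.
  by apply: ball_leq (ball_trans huc' hy); lia.
have odd j : j < rho -> j.*2.+1 <= #|ball j c|.
  elim: j => [_|j IH jr]; first by rewrite cards1.
  by have := IH (ltnW jr); have := grow _ jr; lia.
exists c, rho; split=> //; case: rho hc hmin nsub grow odd => // rho hc hmin nsub _ odd.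
have : ball rho c \proper F by rewrite properE ball_sub // nsub.
by move/proper_card; have := odd rho (ltnSn _); lia.
Qed.

End Ball.

Arguments ball {T} r k x : simpl never.

(** * Counting in graphs of girth at least six *)

Lemma bigminn_le (I : finType) (P : pred I) (F : I -> nat) (x : nat) (i : I) :
  P i -> \big[minn/x]_(j | P j) F j <= F i.
Proof. by rewrite -minEnat -leEnat; apply: bigmin_le_cond. Qed.

Lemma bigminn_le_id (I : finType) (P : pred I) (F : I -> nat) (x : nat) :
  \big[minn/x]_(j | P j) F j <= x.
Proof. by rewrite -minEnat -leEnat; apply: bigmin_le_id. Qed.

Section Graph.
Variable G : sgraph.

Lemma adjC (x y : G) : adj x y -> adj y x.
Proof. by rewrite adj_sym. Qed.

Lemma adj_neq (x y : G) : adj x y -> (x == y) = false.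
Proof. by move=> h; apply/eqP => e; rewrite e adj_irr in h. Qed.

Lemma min_degree_le (v : G) : min_degree G <= degree v.
Proof. exact: bigminn_le. Qed.

Lemma dist_le_ball k (x y : G) : y \in ball adj k x -> dist x y <= k.
Proof.
case/ball_pathP=> p [hs hp hl].
(* A path too long to index the minimum is covered by its default value. *)
have [hlt|hge] := ltnP (size p) #|G|; last first.
  by apply: leq_trans (bigminn_le_id _ _ _) (leq_trans hge hs).
apply: leq_trans hs; rewrite /dist.
apply: (@bigminn_le _ _ (fun k : 'I_#|G| => k : nat) _ (Ordinal hlt)).
by apply/existsP; exists (in_tuple p); rewrite /= hp hl eqxx.
Qed.

Lemma girth_le_cycle (c : seq G) : is_cycle c -> girth G <= size c.
Proof.
move=> hc; have /andP[_ /andP[_ uc]] := hc.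
have hlt : size c < #|G|.+1 by rewrite ltnS -(card_uniqP uc) max_card.
apply: (@bigminn_le _ _ (fun k : 'I_#|G|.+1 => k : nat) _ (Ordinal hlt)).
by apply/existsP; exists (in_tuple c).
Qed.

Definition nbr (x : G) : {set G} := [set y | adj x y].
Definition nbr2 (x : G) : {set G} := \bigcup_(z in nbr x) nbr z.

Lemma card_nbr x : #|nbr x| = degree x. Proof. by []. Qed.

Lemma nbr2P x y : reflect (exists2 z, adj x z & adj z y) (y \in nbr2 x).
Proof.
apply: (iffP bigcupP) => [[z]|[z xz zy]].
  by rewrite !inE; exists z.
by exists z; rewrite inE.
Qed.

Hypothesis girth6 : 6 <= girth G.

Lemma cycle_size_ge6 (c : seq G) : is_cycle c -> 6 <= size c.
Proof. by move/girth_le_cycle; apply: leq_trans. Qed.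

Lemma no_triangle (x y z : G) : adj x y -> adj y z -> adj z x -> False.
Proof.
move=> xy yz zx; have : is_cycle [:: x; y; z].
  rewrite /is_cycle /ucycleb /= xy yz zx /= !inE.
  by rewrite (adj_neq xy) (adj_neq yz) eq_sym (adj_neq zx).
by move/cycle_size_ge6.
Qed.

Lemma no_square (a b c d : G) :
  adj a b -> adj b c -> adj c d -> adj d a -> a = c \/ b = d.
Proof.
move=> ab bc cd da.
case: (eqVneq a c) => [|ac]; first by left.
case: (eqVneq b d) => [|bd]; first by right.
suff /cycle_size_ge6 : is_cycle [:: a; b; c; d] by [].
rewrite /is_cycle /ucycleb /= ab bc cd da /= !inE (negPf ac) (negPf bd).
by rewrite (adj_neq ab) (adj_neq bc) (adj_neq cd) eq_sym (adj_neq da).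
Qed.

Lemma no_closed_walk5 (a b c d e : G) :
  adj a b -> adj b c -> adj c d -> adj d e -> adj e a -> False.
Proof.
move=> ab bc cd de ea.
(* If two vertices two steps apart coincide, the remaining three steps form a triangle. *)
have hne w x y z t : adj w x -> adj x y -> adj y z -> adj z t -> adj t w ->
    (w == y :> G) = false.
  move=> wx xy yz zt tw; apply/eqP => e0; subst y; exact: no_triangle yz zt tw.
suff /cycle_size_ge6 : is_cycle [:: a; b; c; d; e] by [].
rewrite /is_cycle /ucycleb /= ab bc cd de ea /= !inE.
rewrite (adj_neq ab) (adj_neq bc) (adj_neq cd) (adj_neq de).
rewrite (hne a b c d e) // (hne b c d e a) // (hne c d e a b) //.
by rewrite (eq_sym a d) (hne d e a b c) // (eq_sym a e) (adj_neq ea)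
  (eq_sym b e) (hne e a b c d).
Qed.

Lemma common_nbr_uniq (x y a b : G) :
  x != y -> adj x a -> adj y a -> adj x b -> adj y b -> a = b.
Proof.
move=> /eqP xy xa ya xb yb.
by case: (no_square xa (adjC ya) yb (adjC xb)).
Qed.

Variable delta : nat.
Hypothesis hmin : min_degree G = delta.

Lemma delta_le (v : G) : delta <= degree v.
Proof. by rewrite -hmin min_degree_le. Qed.

Lemma nbr2_refl (v : G) : 0 < delta -> v \in nbr2 v.
Proof.
move=> d0; have : 0 < #|nbr v| by rewrite card_nbr; apply: leq_trans (delta_le v).
by case/card_gt0P => a; rewrite inE => va; apply/nbr2P; exists a => //; apply: adjC.
Qed.

(** Each neighbour of [v] has at least [delta.-1] neighbours besides [v], and without 4-cycles no
    vertex other than [v] is counted twice. *)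
Lemma card_nbr2 (v : G) : degree v * delta.-1 <= #|nbr2 v :\ v|.
Proof.
rewrite -[X in _ <= X]muln1; apply: (@double_count _ _ adj (nbr v)) => [a|b].
  rewrite inE => va; suff <- : nbr a :\ v = [set b in nbr2 v :\ v | adj a b].
    have := cardsD1 v (nbr a); rewrite inE (adjC va) card_nbr.
    by have := delta_le a; lia.
  apply/setP => b; rewrite !inE; case: (b == v) => //=.
  by case: (boolP (adj a b)) => ab; rewrite ?andbF //= andbT; apply/esym/nbr2P; exists a.
rewrite !inE eq_sym => /andP[nbv _]; apply/card_le1_eqP => y x.
rewrite !inE => /andP[vy yb] /andP[vx xb].
exact: common_nbr_uniq nbv vx (adjC xb) vy (adjC yb).
Qed.

(** A common vertex would close a walk of length 5 through the edge [x y]. *)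
Lemma adj_nbr2_disjoint (x y : G) : adj x y -> [disjoint nbr2 x & nbr2 y].
Proof.
move=> xy; apply/pred0P => w /=; apply/negP => /andP[/nbr2P[a xa aw] /nbr2P[b yb bw]].
exact: no_closed_walk5 xa aw (adjC bw) (adjC yb) (adjC xy).
Qed.

Lemma nbr2_ball (v : G) : nbr2 v \subset ball adj 2 v.
Proof.
by apply/subsetP => w /nbr2P[a va aw]; apply: ball_step aw; apply: ball1.
Qed.

Lemma card_nbr2_ge (v : G) : 0 < delta -> (delta * delta.-1).+1 <= #|nbr2 v|.
Proof.
move=> d0; have hv := nbr2_refl v d0.
rewrite (cardsD1 v) hv add1n ltnS; apply: leq_trans (card_nbr2 v).
by rewrite leq_mul2r delta_le orbT.
Qed.

Lemma card_edge_ball (x y : G) : 0 < delta -> adj x y ->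
  (delta * delta.-1).+1.*2 <= #|ball adj 2 x :|: ball adj 2 y|.
Proof.
move=> d0 xy; apply: leq_trans (subset_leq_card (setUSS (nbr2_ball x) (nbr2_ball y))).
rewrite -addnn cardsU disjoint_setI0 ?adj_nbr2_disjoint // cards0 subn0.
by rewrite leq_add ?card_nbr2_ge.
Qed.

(** In girth at least 6 this is the sphere of radius 3 around [v]. *)
Definition nbr3 (v : G) : {set G} :=
  [set u | (u \notin nbr v) && [exists w in nbr2 v :\ v, adj w u]].

Lemma nbr3_up (v w : G) : w \in nbr2 v :\ v ->
  delta.-1 <= #|[set u in nbr3 v | adj w u]|.
Proof.
move=> hw; have := cardsID (nbr v) (nbr w); rewrite card_nbr => e.
have -> : [set u in nbr3 v | adj w u] = nbr w :\: nbr v.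
  apply/setP => u; rewrite !in_set; case: (boolP (adj w u)) => wu; last by rewrite !andbF.
  rewrite !andbT; case: (adj v u) => //=; apply/exists_inP; exists w => //.
suff : #|nbr w :&: nbr v| <= 1 by have := delta_le w; lia.
apply/card_le1_eqP => b a; rewrite !inE => /andP[wb vb] /andP[wa va].
by case/setD1P: hw => nwv _; apply: common_nbr_uniq nwv wa va wb vb.
Qed.

(** Each neighbour of [u] counted on the left has at least [delta.-2] further neighbours in
    [nbr3 v]; without 4-cycles, these sets are disjoint for different neighbours. *)
Lemma nbr3_down (v u : G) : u \in nbr3 v ->
  #|[set w in nbr2 v :\ v | adj w u]| * delta.-2 <= #|nbr3 v|.-1.
Proof.
move=> hu; have -> : #|nbr3 v|.-1 = #|nbr3 v :\ u| by rewrite (cardsD1 u) hu.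
rewrite -[X in _ <= X]muln1; apply: (@double_count _ _ adj) => [w|b].
  rewrite in_set => /andP[/nbr3_up hw wu].
  have := cardsD1 u [set b in nbr3 v | adj w b]; rewrite in_set hu wu /=.
  suff -> : [set b in nbr3 v | adj w b] :\ u = [set b in nbr3 v :\ u | adj w b] by lia.
  by apply/setP => b; rewrite !in_set andbA.
rewrite in_setD1 => /andP[nbu _]; apply/card_le1_eqP => y x.
rewrite !in_set => /andP[/andP[_ yu] yb] /andP[/andP[_ xu] xb].
apply: common_nbr_uniq nbu _ _ _ _; exact: adjC.
Qed.

(* A vertex [u] of [nbr3 v] with [k] neighbours in [nbr2 v] forces
   [#|nbr3 v| > k * (delta - 2)], so the degrees from [nbr3 v] back to [nbr2 v]
   are bounded in terms of [#|nbr3 v|] itself. *)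
Lemma card_nbr3 (v : G) : 2 < delta ->
  degree v * delta.-1 ^ 2 * delta.-2 <= #|nbr3 v| * #|nbr3 v|.-1.
Proof.
move=> d2; set t := #|nbr3 v|; have d0 : 0 < delta.-2 by lia.
have h : #|nbr2 v :\ v| * delta.-1 <= t * (t.-1 %/ delta.-2).
  by apply: (@double_count _ _ adj) => [w|u] h; rewrite ?nbr3_up // leq_divRL // nbr3_down.
have h2 := card_nbr2 v; have h3 := leq_divM t.-1 delta.-2.
apply: (@leq_trans (t * (t.-1 %/ delta.-2) * delta.-2)); last by rewrite -mulnA leq_mul2l h3 orbT.
rewrite leq_mul2r; apply/orP; right; apply: leq_trans h.
by rewrite expnS expn1 mulnA leq_mul2r h2 orbT.
Qed.

(** [nbr2 v] meets neither [nbr v] nor [nbr3 v], since an overlap would close a walk of length 3 or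
    5. *)
Lemma card_ball3 (v : G) : 0 < delta ->
  1 + degree v * delta + #|nbr3 v| <= #|ball adj 3 v|.
Proof.
move=> d0; have hv := nbr2_refl v d0.
have dis13 : [disjoint nbr v & nbr3 v].
  by apply/pred0P => u /=; rewrite [X in _ && X]in_set; case: (u \in nbr v).
have dis2 : [disjoint nbr2 v & nbr v :|: nbr3 v].
  apply/pred0P => u /=; apply/negP => /andP[/nbr2P[a va au]].
  rewrite in_setU => /orP[|]; rewrite inE; first by move/adjC; apply: no_triangle va au.
  case/andP=> _ /exists_inP[w /setD1P[_ /nbr2P[b vb bw]] wu].
  by apply: (no_closed_walk5 va au (adjC wu) (adjC bw) (adjC vb)).
have : nbr2 v :|: (nbr v :|: nbr3 v) \subset ball adj 3 v.
  have h2 := subsetP (nbr2_ball v).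
  apply/subsetP => u; rewrite !in_setU => /or3P[/h2|/[1!in_set] /ball1|]; try exact: ball_leq.
  by rewrite in_set => /andP[_ /exists_inP[w /setD1P[_ /h2]]]; apply: ball_step.
move/subset_leq_card; rewrite cardsU disjoint_setI0 // cards0 subn0.
rewrite cardsU disjoint_setI0 // cards0 subn0 (cardsD1 v (nbr2 v)) hv card_nbr.
by have := card_nbr2 v; case: delta d0 => // d _; rewrite mulnS /=; lia.
Qed.

End Graph.

(** * Packing *)

Section Packing.
Variable G : sgraph.

(* A centre together with the vertices reserved for it. *)
Definition cluster : finType := (G * {set G})%type.

(** The 6 is 3 + 3: a cluster lies within 3 of its centre, and a new centre is chosen within 3 of a
    cluster. *)
Definition link (F : {set cluster}) : rel cluster :=
  [rel p q : cluster | [&& p \in F, q \in F & q.1 \in ball adj 6 p.1]].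

Lemma link_sym F : symmetric (link F).
Proof.
have h p q : link F p q -> link F q p.
  by case/and3P=> pF qF h; rewrite /link /= pF qF ball_sym //; apply: adj_sym.
by move=> p q; apply/idP/idP; apply: h.
Qed.

Lemma link_ball F k p q : q \in ball (link F) k p -> q.1 \in ball adj (k * 6) p.1.
Proof.
elim: k q => [q|k IH q]; first by rewrite inE => /eqP->; apply: ball0.
case/ballSP=> [/IH|[z /IH hz /and3P[_ _ hq]]].
  by apply: ball_leq; rewrite leq_mul2r leqnSn orbT.
by rewrite mulSn addnC; apply: ball_trans hq.
Qed.

Lemma boundary_edge (N : {set G}) (x y : G) :
  connect adj x y -> x \in N -> y \notin N ->
  exists a b, [/\ a \in N, b \notin N & adj a b].
Proof.
case/connectP=> p; elim: p x => [x _ -> ->//|z p IH x /= /andP[xz pz] hy xN yN].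
have [zN|zN] := boolP (z \in N); first exact: IH pz hy zN yN.
by exists x, z.
Qed.

(** The last clause makes the link graph on [F] connected, so that it has a centre. *)
Definition packing (s : nat) (r0 : cluster) (F : {set cluster}) : bool :=
  [&& r0 \in F,
      [forall p in F, (s <= #|p.2|) && (p.2 \subset ball adj 3 p.1)],
      [forall p in F, forall q in F, (p != q) ==> [disjoint p.2 & q.2]]
    & [forall p in F, connect (link F) r0 p]].

(* The distance from [y] to the union of the clusters is exactly 3, so that
   the new cluster is disjoint from the others but still linked to one of them. *)
Lemma packing_extend s r0 F y y' :
  packing s r0 F -> adj y y' -> s <= #|ball adj 2 y :|: ball adj 2 y'| ->
  (exists2 p, p \in F & exists2 u, u \in p.2 & y \in ball adj 3 u) ->
  (forall p u, p \in F -> u \in p.2 -> y' \notin ball adj 3 u) ->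
  packing s r0 ((y, ball adj 2 y :|: ball adj 2 y') |: F).
Proof.
set B := _ :|: _; case/and4P=> r0F /forall_inP hF /forall_inP hdis /forall_inP hcon.
move=> yy' hs [p0 p0F [u0 u0p yu0]] hfar.
have sB : B \subset ball adj 3 y.
  apply/subsetP => w; rewrite in_setU => /orP[|hw]; first exact: ball_leq.
  exact: (ball_trans (ball1 yy') hw).
have dB p : p \in F -> [disjoint B & p.2].
  move=> pF; apply/pred0P => w /=; apply/negP => /andP[wB wp].
  have /negP[] := hfar p w pF wp; case/setUP: wB => /(ball_sym (@adj_sym G)) h.
    exact: ball_step h yy'.
  exact: ball_leq h.
have sub : subrel (link F) (link ((y, B) |: F)).
  by move=> p q /and3P[pF qF h]; rewrite /link /= !in_setU pF qF !orbT.
have con p : p \in F -> connect (link ((y, B) |: F)) r0 p.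
  move/hcon; apply: connect_sub => a b /sub; exact: connect1.
apply/and4P; split; first by rewrite in_setU r0F orbT.
- by apply/forall_inP => p /setU1P[->|/hF//]; rewrite hs sB.
- apply/forall_inP => p /setU1P[->|pF]; apply/forall_inP => q /setU1P[->|qF].
  + by rewrite eqxx.
  + by rewrite dB ?implybT.
  + by rewrite disjoint_sym dB ?implybT.
  + by move/forall_inP: (hdis p pF); apply.
- apply/forall_inP => p /setU1P[->|]; last exact: con.
  apply: connect_trans (con _ p0F) (connect1 _).
  rewrite /link /= !in_setU p0F orbT in_set1 eqxx /=.
  have /andP[_ /subsetP h] := hF _ p0F.
  exact: (ball_trans (h _ u0p) yu0).
Qed.

(** A maximal packing leaves no vertex farther than 3 from the clusters: an edge [y y'] leaving this
    neighbourhood would give a further cluster by [packing_extend]. *)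
Lemma packing_exists s (v : G) :
  connected_graph G ->
  (forall x y : G, adj x y -> s <= #|ball adj 2 x :|: ball adj 2 y|) ->
  s <= #|ball adj 3 v| ->
  exists F, packing s (v, ball adj 3 v) F /\
    forall x, exists2 p : cluster, p \in F & x \in ball adj 6 p.1.
Proof.
move=> [_ hconn] hedge hv; set r0 : cluster := (v, ball adj 3 v).
have p1 : packing s r0 [set r0].
  apply/and4P; split; first by rewrite in_set1.
  - by apply/forall_inP => p /set1P->; rewrite hv /=.
  - by apply/forall_inP => p /set1P->; apply/forall_inP => q /set1P->; rewrite eqxx.
  - by apply/forall_inP => p /set1P->; apply: connect0.
have [F /maxsetP[hF hmax] _] := maxset_exists p1.
exists F; split=> // x; have /and4P[r0F /forall_inP hsub _ _] := hF.
pose N := [set x | [exists p in F, exists u in p.2, x \in ball adj 3 u]].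
have inN p u z : p \in F -> u \in p.2 -> z \in ball adj 3 u -> z \in N.
  by move=> pF up zu; rewrite in_set; apply/exists_inP; exists p => //; apply/exists_inP; exists u.
have [xN|xN] := boolP (x \in N).
  move: xN; rewrite in_set => /exists_inP[p pF /exists_inP[u up xu]]; exists p => //.
  have /andP[_ /subsetP h] := hsub _ pF.
  exact: (ball_trans (h _ up) xu).
have vN : v \in N by apply: (inN r0 v); rewrite ?(ball_leq _ (ball0 _ v)).
have [y [y' [yN y'N yy']]] := boundary_edge (hconn v x) vN xN.
set B := ball adj 2 y :|: ball adj 2 y'.
have hp : packing s r0 ((y, B) |: F).
  apply: packing_extend => //; first exact: hedge.
    move: yN; rewrite in_set => /exists_inP[p pF /exists_inP[u up yu]].
    by exists p => //; exists u.
  by move=> p u pF up; apply: contra y'N; apply: inN pF up.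
have := hmax _ hp (subsetUr _ _) => /setP/(_ (y, B)); rewrite setU11 => /esym bF.
case/negP: y'N; apply: (inN (y, B) y y' bF); last exact: (ball_leq _ (ball1 yy')).
by rewrite /B /= in_setU (ball_leq _ (ball0 _ y)).
Qed.

Lemma packing_uniq s r0 F p q x : packing s r0 F ->
  p \in F -> q \in F -> x \in p.2 -> x \in q.2 -> p = q.
Proof.
case/and4P=> _ _ /forall_inP hdis _ pF qF xp xq; apply/eqP/negPn/negP => npq.
have /forall_inP/(_ _ qF) := hdis p pF; rewrite npq /= => /pred0P/(_ x) /=.
by rewrite xp xq.
Qed.

(** The clusters other than [r0] fit disjointly into the complement of [r0.2]; adding [s] on the
    right avoids a truncated subtraction. *)
Lemma packing_size s r0 F : packing s r0 F -> #|F| * s + #|r0.2| <= #|G| + s.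
Proof.
move=> hF; have /and4P[r0F /forall_inP hs _ _] := hF.
rewrite (cardsD1 r0 F) r0F -(cardsC r0.2).
suff : #|F :\ r0| * s <= #|~: r0.2| * 1 by lia.
apply: (@double_count _ _ (fun (p : cluster) x => x \in p.2)) => [p|x].
  case/setD1P=> np pF; have /andP[hp _] := hs p pF; apply: leq_trans hp _.
  apply/subset_leq_card/subsetP => x xp; rewrite !inE xp andbT.
  by apply: contraNN np => xr; apply/eqP; apply: (packing_uniq hF pF r0F xp xr).
move=> _; apply/card_le1_eqP => p q.
rewrite !inE => /andP[/andP[_ pF] xp] /andP[/andP[_ qF] xq].
exact: packing_uniq hF qF pF xq xp.
Qed.

Lemma sum_odd n : \sum_(j < n) j.*2.+1 = n ^ 2.
Proof. by elim: n => [|n IH]; rewrite ?big_ord0 // big_ord_recr /= IH; lia. Qed.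

(* Averaging over [x] bounds the distances from the cluster of [x] to a centre of
   the link graph: the balls of radius [j] in that graph contain at least [2j+1]
   clusters, hence at least [(2j+1) * s] vertices of [G]. *)
Lemma sum_ecc_le s (v : G) :
  connected_graph G ->
  (forall x y : G, adj x y -> s <= #|ball adj 2 x :|: ball adj 2 y|) ->
  s <= #|ball adj 3 v| ->
  exists rho, \sum_(x : G) ecc x + 6 * s * rho ^ 2 <= 12 * #|G| * rho.+1 /\
    rho.*2 * s + #|ball adj 3 v| <= #|G| + s.
Proof.
move=> hconn hedge hv.
have [F [hF hcov]] := packing_exists hconn hedge hv.
have /and4P[r0F /forall_inP hs _ /forall_inP hcon] := hF.
have linkF p q : link F p q -> q \in F by case/and3P.
have r0ball : F \subset ball (link F) #|cluster| (v, ball adj 3 v).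
  by apply/subsetP => p /hcon/connect_ball.
have [c [rho [cF hc hodd hrho]]] := center_exists (@link_sym F) linkF r0F r0ball.
exists rho; split; last first.
  apply: leq_trans (packing_size hF); rewrite leq_add2r leq_mul2r hrho; exact: orbT.
(* [cl x] is the cluster containing [x] or, when there is none, one whose centre is within 6 of
   [x]. *)
have /fin_all_exists[cl hcl] : forall x, exists p : cluster,
    [/\ p \in F, x \in ball adj 6 p.1 & forall q, q \in F -> x \in q.2 -> p = q].
  move=> x; case: (pickP [pred p in F | x \in p.2]) => [p /andP[/= pF xp]|hno].
    have /andP[_ /subsetP h] := hs p pF.
    exists p; split=> //; first by apply: ball_leq (h _ xp).
    by move=> q qF xq; apply: packing_uniq hF pF qF xp xq.
  have [p pF xp] := hcov x; exists p; split=> // q qF xq.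
  by have := hno q; rewrite /= qF xq.
(* [far x] is the link distance from [c] to [cl x], at most [rho], and [near x] is its complement to
   [rho]. *)
pose near x := \sum_(j < rho) (cl x \in ball (link F) j c).
pose far x := \sum_(j < rho) (cl x \notin ball (link F) j c).
have near_far x : near x + far x = rho.
  rewrite -big_split /= -[RHS](card_ord rho) -sum1_card.
  by apply: eq_bigr => j _; case: (_ \in _).
(* The route from [x] to [y] visits the centres of [cl x], [c] and [cl y], with lengths at most [6],
   [6 * far x], [6 * rho] and [6]. *)
have ecc_far x : ecc x <= 12 + 6 * (rho + far x).
  apply/bigmax_leqP => y _; apply: dist_le_ball.
  have [clxF xcl _] := hcl x; have [clyF ycl _] := hcl y.
  have hx := ball_sym (@adj_sym G) (link_ball (ball_sum (subsetP hc _ clxF))).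
  have hy := link_ball (subsetP hc _ clyF).
  apply: ball_leq (ball_trans (ball_trans (ball_trans
    (ball_sym (@adj_sym G) xcl) hx) hy) ycl).
  by rewrite -/(far x); lia.
have near_ge : s * rho ^ 2 <= \sum_x near x.
  rewrite /near exchange_big /= -sum_odd big_distrr /=; apply: leq_sum => j _.
  apply: (@leq_trans (#|ball (link F) j c| * s)).
    by rewrite mulnC leq_mul2r hodd ?orbT.
  rewrite -big_mkcond sum1dep_card -[X in _ <= X]muln1.
  apply: (@double_count _ _ (fun p x => cl x == p)) => [p pj|x _].
    have pF := subsetP (ball_sub j linkF cF) _ pj.
    have /andP[hp _] := hs p pF; apply: leq_trans hp _.
    apply/subset_leq_card/subsetP => x xp; have [_ _ /(_ p pF xp) e] := hcl x.
    by rewrite !inE e pj eqxx.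
  by apply/card_le1_eqP => p q; rewrite !inE => /andP[_ /eqP<-] /andP[_ /eqP<-].
have : \sum_(x : G) ecc x <= \sum_(x : G) (12 + 6 * (rho + far x)).
  by apply: leq_sum => x _; apply: ecc_far.
have : \sum_x near x + \sum_x far x = #|G| * rho.
  by rewrite -big_split /= (eq_bigr _ (fun x _ => near_far x)) sum_nat_const.
have -> : \sum_(x : G) (12 + 6 * (rho + far x)) = #|G| * 12 + 6 * (#|G| * rho + \sum_x far x).
  by rewrite big_split /= sum_nat_const -big_distrr /= big_split /= sum_nat_const.
by move: near_ge; nia.
Qed.
End Packing.

(** * The bound *)

Local Open Scope ring_scope.

Lemma Delta_star_ge0 (R : rcfType) (Delta delta : nat) :
  (1 <= delta)%N -> 0 <= Delta_star R Delta delta.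
Proof.
move=> h; have h1 : (1 : R) <= delta%:R by rewrite ler1n.
rewrite /Delta_star; have := sqrtr_ge0 (Delta%:R * (delta%:R - 2) : R).
have : (0 : R) <= Delta%:R by []. nra.
Qed.

(** Here [t] stands for the size of [nbr3]. The [3 / 2] in [Delta_star] is 1 for the central vertex
    plus 1/2 from completing the square. *)
Lemma Delta_star_le (R : rcfType) (Delta d delta t : nat) :
  (Delta <= d)%N -> (3 <= delta)%N ->
  (0 < t)%N ->
  (d * delta.-1 ^ 2 * delta.-2 <= t * t.-1)%N ->
  Delta_star R Delta delta <= (1 + d * delta + t)%:R.
Proof.
move=> hD; case: delta => [|[|[|e]]] // _; case: t => // t _ /=.
rewrite -(ler_nat R) !natrM => ht.
have hD' : (Delta%:R : R) <= d%:R by rewrite ler_nat.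
have D0 : (0 : R) <= Delta%:R by exact: ler0n.
have e0 : (0 : R) <= e%:R by [].
have t0 : (0 : R) <= t%:R by [].
rewrite /Delta_star; set q := Num.sqrt _.
have q0 : 0 <= q by apply: sqrtr_ge0.
have q2 : q ^+ 2 = Delta%:R * (e%:R + 1).
  rewrite sqr_sqrtr -(natr1 e.+2) -(natr1 e.+1) -(natr1 e); first by ring.
  by apply: mulr_ge0 => //; lra.
(* [d (delta-1)^2 (delta-2) <= t (t-1)] gives this by completing the square. *)
have hq : (e%:R + 2) * q <= t%:R + 1 / 2.
  rewrite -ler_sqr ?nnegrE; [| by apply: mulr_ge0 => //; lra | lra].
  rewrite exprMn q2; move: ht.
  rewrite -(natr1 t) -(natr1 e.+1) -(natr1 e).
  have : 0 <= (d%:R - Delta%:R : R) * ((e%:R + 2) ^+ 2 * (e%:R + 1)).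
    by rewrite mulr_ge0 ?subr_ge0 // mulr_ge0 ?sqr_ge0 //; lra.
  nra.
have : 0 <= (d%:R - Delta%:R : R) * (e%:R + 3).
  by rewrite mulr_ge0 ?subr_ge0 //; lra.
rewrite !natrD natrM -(natr1 e.+2) -(natr1 e.+1) -(natr1 e) -(natr1 t).
nra.
Qed.

(* [phi s = 6 s - 3 s^2 p / (2 n)] increases up to [2 n / p] and has slope at most 6;
   the bound compares its values at [2 rho] and at [(n - D) / p >= 2 rho - 1]. *)
Lemma avec_arith (R : realFieldType) (n p D rho S b : R) :
  0 < n -> 0 < p -> 0 <= D -> D <= b -> b <= n ->
  S + 6 * p * rho ^+ 2 <= 12 * n * (rho + 1) ->
  2 * rho * p + b <= n + p ->
  S / n <= (n - D) / (2 * p) * ((9 * n + 3 * D) / n) + 21.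
Proof.
move=> n0 p0 D0 Db bn hS hr.
pose k := (n - D) / p.
have kp : k * p = n - D by rewrite /k mulfVK // gt_eqF.
have k0 : 0 <= k by rewrite /k divr_ge0 //; lra.
have kn : k * p <= n by lra.
have -> : (n - D) / (2 * p) * ((9 * n + 3 * D) / n) + 21
  = (k / 2 * (9 * n + 3 * D) + 21 * n) / n.
  by rewrite /k; field; rewrite !gt_eqF.
rewrite ler_pM2r ?invr_gt0 //.
have -> : D = n - k * p by lra.
have h1 : (2 * rho - k) * p <= p by lra.
have h2 : 2 * rho - k <= 1 by rewrite -(ler_pM2r p0) mul1r.
set s := 2 * rho in h1 h2 *.
have -> : k / 2 * (9 * n + 3 * (n - k * p)) = 6 * n * k - 3 / 2 * p * k ^+ 2 by field.
have hS' : S <= 12 * n + 6 * n * s - 3 / 2 * p * s ^+ 2.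
  by rewrite /s; lra.
(* Of the [21 n], [12 n] matches the constant term of [hS']; the other [9 n] covers the overshoot
   [s - k <= 1], which costs at most [6 n]. *)
suff : 6 * n * s - 3 / 2 * p * s ^+ 2 <= 6 * n * k - 3 / 2 * p * k ^+ 2 + 9 * n by lra.
have [sk|ks] := lerP s k.
  (* As [p * s <= p * k <= n], the second factor is at least [3 n]. *)
  have : 0 <= (k - s) * (6 * n - 3 / 2 * p * (s + k)).
    apply: mulr_ge0; first lra.
    have : p * s <= p * k by rewrite ler_pM2l.
    lra.
  lra.
have : (s - k) * n <= 1 * n by rewrite ler_pM2r.
have : 0 <= (s - k) * (p * (s + k)).
  by rewrite mulr_ge0 ?mulr_ge0 //; lra.
lra.
Qed.

Theorem theorem5 (R : rcfType) (G : sgraph) (n delta Delta : nat)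
    (hconn : connected_graph G)
    (hn : #|G| = n)
    (hmin : min_degree G = delta)
    (hdelta : (3 <= delta)%N)
    (hmax : (Delta <= max_degree G)%N)
    (hgirth : (6 <= girth G)%N) :
  avec R G <=
    (n%:R - Delta_star R Delta delta) / (2 * delta_star R delta)
      * ((9 * n%:R + 3 * Delta_star R Delta delta) / n%:R) + 21.
Proof.
have [G0 _] := hconn; have delta0 : (0 < delta)%N by apply: leq_trans hdelta.
have [v hv] := bigop.eq_bigmax (@degree G) G0.
have dv := delta_le hmin v.
set s := ((delta * delta.-1).+1.*2)%N.
have hedge (x y : G) : adj x y -> (s <= #|ball adj 2 x :|: ball adj 2 y|)%N.
  by move=> xy; apply: (card_edge_ball hgirth hmin delta0 xy).
(* The ball of radius 3 contains an edge neighbourhood, so it is large enough to be a cluster. *)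
have hs : (s <= #|ball adj 3 v|)%N.
  have : (0 < degree v)%N by apply: leq_trans dv.
  case/card_gt0P => w; rewrite inE => vw; apply: leq_trans (hedge _ _ vw) _.
  apply/subset_leq_card/subsetP => x; rewrite in_setU => /orP[|hx].
    exact: ball_leq.
  exact: (ball_trans (ball1 vw) hx).
have [rho [h1 h2]] := sum_ecc_le hconn hedge hs.
have es : s%:R = delta_star R delta.
  rewrite /s /delta_star -(prednK delta0) /= -muln2 natrM -natr1 natrM -natr1; ring.
have h3 := card_nbr3 hgirth hmin v hdelta.
have t0 : (0 < #|nbr3 v|)%N.
  move: h3; case: #|_| => //; rewrite mul0n leqn0 !muln_eq0; lia.
rewrite /avec hn; apply: (@avec_arith R n%:R _ _ rho%:R _ #|ball adj 3 v|%:R).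
- by rewrite -hn ltr0n.
- by rewrite -es ltr0n.
- exact: Delta_star_ge0.
- apply: le_trans (Delta_star_le R _ hdelta t0 h3) _; first by rewrite -hv.
  by rewrite ler_nat card_ball3.
- by rewrite -hn ler_nat max_card.
- by move: h1; rewrite -(ler_nat R) hn natrD !natrM es natr1.
- by move: h2; rewrite -(ler_nat R) hn !natrD -mul2n !natrM es.
Qed.
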